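(* Consider an instance of the reentrant flow shop problem with unit processing times in which the weights and the numbers of loops are agreeable. Then the Least Remaining Loops First (LRL) priority rule, with ties broken by the highest weight, minimizes the total weighted completion time $\sum_{j=1}^n w_jC_j$ among all schedules.
   Context: Reentrant flow shop with unit processing times: there are $m\ge 1$ machines in series and $n$ jobs. Job $j$ must traverse the shop $\mathcal{L}_j\ge 1$ times (loops $k=1,\dots,\mathcal{L}_j$, with $\mathcal{L}_j$ an integer) and has weight $w_j>0$. In each loop it is processed for one time unit on each of the machines $1,2,\dots,m$ in this order. Once a loop is started on machine $1$ it proceeds through all machines without waiting. A schedule is an assignment of start times $S_{jk}\in\{0,1,2,\dots\}$ on machine $1$ to all loops $(j,k)$ such that distinct loops have distinct start times and $S_{jk}\ge C_{j,k-1}$ for $k\ge 2$, where $C_{jk}=S_{jk}+m$ is the completion time of loop $k$ of job $j$ on machine $m$. The completion time of job $j$ is $C_j=C_{j\mathcal{L}_j}$. Job $j$ is available at time $t$ if it still has loops that have not been started before $t$ and all its previously started loops are completed on machine $m$ by time $t$. Its number of remaining loops at that time is the number of its loops not yet started. The LRL priority rule: at each time $t=0,1,2,\dots$ at which at least one job is available, start on machine $1$ the next loop of an available job with the least number of remaining loops among all available jobs; machine $1$ is idle only if no job is available. Here, ties are broken in favor of a job with the highest weight. Agreeable: the weights and numbers of loops are agreeable if any two distinct jobs can be named $j,j'$ in such a way that $\mathcal{L}_j\le\mathcal{L}_{j'}$ and $w_j\ge w_{j'}$, with at least one of these two inequalities strict. *)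

(* Defs.v *)
From mathcomp Require Import all_boot all_order all_algebra.
Set Implicit Arguments.
Unset Strict Implicit.
Unset Printing Implicit Defensive.
Import Order.TTheory GRing.Theory Num.Theory.

(* The jobs are the elements of 'I_n.  Loops are numbered from 1, so the loops
   of job j are the k in loops (L j).  Start times on machine 1 are given by
   S : 'I_n -> nat -> nat; the values S j k for k outside loops (L j) have no
   meaning and are never inspected by the definitions below. *)
Definition loops (l : nat) : seq nat := iota 1 l.

Section ReentrantFlowShop.

Variables (R : realFieldType) (m n : nat) (L : 'I_n -> nat) (w : 'I_n -> R).

Definition agreeable_pair (j j' : 'I_n) : Prop :=
  [/\ L j <= L j', (w j' <= w j)%R & L j < L j' \/ (w j' < w j)%R].

Definition agreeable : Prop :=
  forall j j' : 'I_n, j != j' -> agreeable_pair j j' \/ agreeable_pair j' j.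

Section Schedule.

Variable S : 'I_n -> nat -> nat.

(* A started loop proceeds without waiting and takes one time unit on each of
   the m machines. *)
Definition loop_completion (j : 'I_n) (k : nat) : nat := S j k + m.

Definition is_schedule : Prop :=
  (forall (j j' : 'I_n) (k k' : nat),
     k \in loops (L j) -> k' \in loops (L j') ->
     S j k = S j' k' -> j = j' /\ k = k') /\
  (forall (j : 'I_n) (k : nat),
     k \in loops (L j) -> 2 <= k -> loop_completion j k.-1 <= S j k).

Definition job_completion (j : 'I_n) : nat := loop_completion j (L j).

Definition total_weighted_completion : R :=
  (\sum_(j < n) w j * (job_completion j)%:R)%R.

Definition remaining_loops (t : nat) (j : 'I_n) : nat :=
  count (fun k => t <= S j k) (loops (L j)).

Definition available (t : nat) (j : 'I_n) : bool :=
  has (fun k => t <= S j k) (loops (L j)) &&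
  all (fun k => (S j k < t) ==> (loop_completion j k <= t)) (loops (L j)).

Definition next_loop (t : nat) (j : 'I_n) (k : nat) : Prop :=
  [/\ k \in loops (L j), t <= S j k &
      forall i, i \in loops (L j) -> i < k -> S j i < t].

Definition LRL_choice (t : nat) (j : 'I_n) : Prop :=
  available t j /\
  forall j' : 'I_n, available t j' ->
    remaining_loops t j < remaining_loops t j' \/
    remaining_loops t j = remaining_loops t j' /\ (w j' <= w j)%R.

(* Jobs with equal remaining loops and equal weights may be chosen in any
   order, so the rule may generate several schedules.  In a schedule a loop can
   start at t only if its job is available at t, and distinct loops start at
   distinct times, so nothing else need be said about the starts at time t. *)
Definition is_LRL_schedule : Prop :=
  is_schedule /\
  forall t : nat, (exists j, available t j) ->
    exists j k, [/\ LRL_choice t j, next_loop t j k & S j k = t].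

End Schedule.

End ReentrantFlowShop.

(* Main.v *)
Require Import Defs.
From mathcomp Require Import all_boot all_order all_algebra.
From mathcomp Require Import zify.

(** A loop occupies one slot of machine 1 and its job may return m slots later.
    So the m residue classes of the slots modulo m behave like m parallel
    machines (called tracks below), and a job that is never kept waiting stays
    on one track.  Agreeability makes the jobs a strict total order: few loops
    and high weight come first; rank numbers the jobs in this order.

    An LRL schedule never makes a started job wait.  When a job starts, every
    job that starts later has at least as many loops; once the job has finished
    a loop, it has strictly fewer remaining loops than any of these, and no
    other started job competes for its slot (no_wait).  Hence LRL is list
    scheduling, without preemption, of the jobs by rank on m parallel tracks:
    the job of rank i starts at i if i < m, and otherwise when the job of rank
    i - m ends (LRL_first_start, LRL_completion).  In particular its completion
    times do not depend on how ties are broken.  Conversely this explicit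
    schedule obeys the rule, which gives existence (track_schedule_is_LRL).

    For the lower bound, note that weights decrease along the ranks, so the
    weight function is a nonnegative combination of indicators of prefixes of
    the rank order (Abel summation, weighted_sum_ge0).  It is then enough to
    bound the unweighted sum of completion times over each prefix, and this is
    done for any set B of jobs (track_completions_le).  Let A consist of the min(m, |B|) jobs of B that
    complete last.  At each time the number of loops of B in process is at most
    the number of unfinished jobs of A, and it is at most t + 1 at time t.
    Integrating over time bounds the sum of the completion times over A from
    below by m times the number of loops of B plus 0 + 1 + ... + (|A| - 1)
    (volume_bound).  For the first |B| jobs of an LRL schedule this is an
    equality (sum_track_end), and the bound follows by induction, removing A
    from B. *)

Set Implicit Arguments.
Unset Strict Implicit.
Unset Printing Implicit Defensive.
Import Order.TTheory GRing.Theory Num.Theory.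

(** * List scheduling on m parallel tracks *)

Section Tracks.

Variables (m : nat) (l : nat -> nat).
Hypotheses (m_gt0 : 0 < m) (l_gt0 : forall i, 0 < l i).
Hypothesis l_mono : {homo l : i j / i <= j}.

(** Job i, with l i loops, goes to track i mod m, which takes the jobs i mod m,
    i mod m + m, i mod m + 2m, ... in this order without idle time.  All jobs
    before i on this track contribute to the sum.  By track_startD, the job
    ends at track_start (i + m). *)
Definition track_start (i : nat) : nat :=
  i %% m + m * \sum_(q < i %/ m) l (i %% m + q * m).

Lemma track_start_small i : i < m -> track_start i = i.
Proof.
by move=> lt_im; rewrite /track_start divn_small // big_ord0 muln0 addn0 modn_small.
Qed.

Lemma track_startD i : track_start (i + m) = track_start i + m * l i.
Proof.
rewrite /track_start modnDr divnDr // divnn m_gt0 addn1 big_ord_recr /=.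
by rewrite [i %% m + _ * m]addnC -divn_eq mulnDr addnA.
Qed.

Lemma track_start_mod i : track_start i = i %[mod m].
Proof. by rewrite /track_start addnC mulnC modnMDl modn_mod. Qed.

(** By induction along the tracks: jobs i and i + 1 start when i - m and i + 1 - m
    end, and the later of these two is also at least as long.  The case
    i + 1 = m compares the last of the first starts with the second start on
    track 0. *)
Lemma track_start_lt : {homo track_start : i i' / i < i'}.
Proof.
apply: homo_ltn => [y x z|i]; first exact: ltn_trans.
elim/ltn_ind: i => i IH.
have [lt_im|le_mi] := ltnP i m.
  have [lt_i1m|le_mi1] := ltnP i.+1 m; first by rewrite !track_start_small.
  have -> : i.+1 = 0 + m by lia.
  rewrite track_startD !track_start_small // add0n.
  by rewrite (leq_trans lt_im) // leq_pmulr.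
rewrite -(subnK le_mi) -addSn !track_startD -addSn leq_add //.
  by apply: IH; lia.
by rewrite leq_mul2l l_mono ?orbT.
Qed.

Lemma track_start_le : {mono track_start : i i' / i <= i'}.
Proof. exact/leq_mono/track_start_lt. Qed.

(** A track is never idle, since l describes infinitely many jobs. *)
Lemma track_cover t :
  exists2 i, i = t %[mod m] & track_start i <= t < track_start (i + m).
Proof.
elim/ltn_ind: t => t IH.
have [lt_tm|le_mt] := ltnP t m.
  exists t => //; rewrite track_startD track_start_small // leqnn /=.
  by rewrite -[t in t < _]addn0 ltn_add2l muln_gt0 m_gt0 l_gt0.
have [|i Ei /andP[le_it lt_ti]] := IH (t - m); first by lia.
have Ei' : i = t %[mod m] by rewrite Ei -{2}(subnK le_mt) modnDr.
have [lt_t|le_t] := ltnP t (track_start (i + m)).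
  by exists i => //; rewrite lt_t andbT; lia.
exists (i + m); first by rewrite modnDr.
rewrite le_t [track_start (i + m + m)]track_startD /=.
have : m <= m * l (i + m) by rewrite leq_pmulr.
lia.
Qed.

Lemma track_end_le i i' : i = i' %[mod m] -> i < i' ->
  track_start (i + m) <= track_start i'.
Proof.
move=> /eqP; rewrite eq_sym => Ei lt_ii'; rewrite track_start_le.
have := Ei; rewrite eqn_mod_dvd; last exact: ltnW.
by move=> /dvdn_leq; rewrite subn_gt0 lt_ii' => /(_ isT); lia.
Qed.

(** Each job ends m * l i after it starts, and every start is either one of the
    first m slots or the end of the job m places earlier.  The last term is the
    same sum for b - m jobs, so that the other two give the total completion
    time of the last min(m, b) jobs. *)
Lemma sum_track_end b :
  \sum_(i < b) track_start (i + m) =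
  m * (\sum_(i < b) l i) + \sum_(i < minn m b) i +
  \sum_(i < b - m) track_start (i + m).
Proof.
under eq_bigr do rewrite track_startD.
rewrite big_split /= -big_distrr /= -addnA addnC; congr (_ + _).
have [le_bm|lt_mb] := leqP b m.
  have -> : b - m = 0 by lia.
  rewrite big_ord0 addn0.
  by apply: eq_bigr => i _; rewrite track_start_small // (leq_trans _ le_bm).
rewrite -(subnKC (ltnW lt_mb)) big_split_ord addKn /=; congr (_ + _).
  by apply: eq_bigr => i _; rewrite track_start_small.
by apply: eq_bigr => i _; rewrite addnC.
Qed.

End Tracks.

(** * Sums over finite sets and over time *)

(** A consists of c elements of B with the largest values of f.  The threshold
    tau is what the counting argument of volume_bound needs: before tau all of A
    is unfinished, from tau on nothing outside A is. *)
Lemma top_subset (T : finType) (f : T -> nat) (B : {set T}) c : c <= #|B| ->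
  exists (A : {set T}) (tau : nat),
    [/\ A \subset B, #|A| = c, forall j, j \in A -> tau <= f j &
        forall j, j \in B :\: A -> f j <= tau].
Proof.
elim: c => [_|c IH lt_cB].
  exists set0, (\max_j f j); split; rewrite ?sub0set ?cards0 // => j.

    by rewrite in_set0.
  by move=> _; apply: leq_bigmax.
have [A [tau [sAB cardA leA geA]]] := IH (ltnW lt_cB).
have /card_gt0P[x0 x0BA] : 0 < #|B :\: A|.
  by have := cardsID A B; rewrite (setIidPr sAB) cardA; lia.
case: (arg_maxnP f x0BA) => x xBA max_x.
have /setDP[xB xA] := xBA.
exists (x |: A), (f x); split.
- by rewrite subUset sub1set xB.
- by rewrite cardsU1 xA cardA.
- move=> j /setU1P[->|jA] //.
  exact: leq_trans (geA _ xBA) (leA _ jA).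
- move=> j; rewrite !inE negb_or => /andP[/andP[_ jA] jB].
  by apply: max_x; apply/setDP.
Qed.

Lemma sum_first_le_sum_image (T : finType) (r : T -> nat) (g : nat -> nat)
    (B : {set T}) :
  injective r -> {homo g : i j / i <= j} ->
  \sum_(i < #|B|) g i <= \sum_(j in B) g (r j).
Proof.
move=> r_inj g_mono; move Eb: #|B| => b.
elim: b B Eb => [|b IH] B Eb; first by rewrite big_ord0.
have /card_gt0P[x0 x0B] : 0 < #|B| by rewrite Eb.
case: (arg_maxnP r x0B) => x xB max_x.
rewrite (big_setD1 x xB) /= big_ord_recr /= addnC leq_add //; last first.
  by apply: IH; have := cardsD1 x B; rewrite (xB : x \in B) Eb; lia.
apply: g_mono.
(* Otherwise r would embed the b.+1 elements of B into {0, ..., b - 1}. *)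
rewrite leqNgt; apply/negP => lt_xb.
suff: b.+1 <= b by rewrite ltnn.
rewrite -{1}Eb cardE -(size_map r) -[leqRHS](size_iota 0).
apply: uniq_leq_size => [|_ /mapP[j jB ->]]; first by rewrite map_inj_uniq ?enum_uniq.
rewrite mem_enum in jB; rewrite mem_iota.
exact: leq_ltn_trans (max_x _ jB) lt_xb.
Qed.

Lemma sum_nat_of_bool (T : Type) (s : seq T) (p : pred T) :
  \sum_(x <- s) p x = count p s.
Proof. by rewrite -sum1_count [RHS]big_mkcond; apply: eq_bigr => x _; case: (p x). Qed.

Lemma count_iota_lt a n : count (fun t => t < a) (iota 0 n) = minn a n.
Proof.
elim: n => [|n IH]; first by rewrite minn0.
rewrite -addn1 iotaD count_cat IH add0n /= addn0; case: ltnP; lia.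
Qed.

Lemma sum_ord_lt a n : a <= n -> \sum_(t < n) (t < a) = a.
Proof.
move=> le_an; rewrite -[RHS](minn_idPl le_an) -count_iota_lt.
by rewrite -sum_nat_of_bool -val_enum_ord big_map big_enum.
Qed.

Lemma sum_ord_window s m n : s + m <= n -> \sum_(t < n) (s <= t < s + m) = m.
Proof.
move=> le_n; apply/eqP; rewrite -(eqn_add2l s); apply/eqP.
rewrite -[RHS](sum_ord_lt le_n) -{1}(@sum_ord_lt s n); last by lia.
rewrite -big_split /=; apply: eq_bigr => t _.
by case: (ltnP t s) => ?; case: (ltnP t (s + m)) => ? //=; lia.
Qed.

(** The summand is the shortfall, at time t, of the at most t + 1 loops that can
    be in process with respect to a capacity c. *)
Lemma sum_ord_countdown c n : c <= n -> \sum_(t < n) (c - t.+1) = \sum_(i < c) i.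
Proof.
move=> /subnKC <-; rewrite big_split_ord /= [X in _ + X]big1 ?addn0.
  by rewrite (reindex_inj rev_ord_inj) /=; apply: eq_bigr => i _; have := ltn_ord i; lia.
by move=> i _; lia.
Qed.

(** * A lower bound on completion times in any schedule *)

Lemma mem_loops l k : (k \in loops l) = (0 < k <= l).
Proof. by rewrite mem_iota add1n ltnS. Qed.

Section LowerBound.

Variables (m n : nat) (L : 'I_n -> nat) (S : 'I_n -> nat -> nat).
Hypothesis m_gt0 : 0 < m.
Hypothesis sched : is_schedule m L S.

Lemma loop_start_spacing j k k' :
  0 < k -> k < k' -> k' <= L j -> S j k + m <= S j k'.
Proof.
move=> k_gt0; elim: k' => // k' IH; rewrite ltnS => le_kk' le_k'L.
have := sched.2 j k'.+1; rewrite mem_loops le_k'L /loop_completion /=.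
move=> /(_ isT) le_S; have [|eq_kk'] := ltnP k k'.
  by move=> lt_kk'; have := IH lt_kk' (ltnW le_k'L); have := le_S ltac:(lia); lia.
have -> : k = k' by lia.
by apply: le_S; lia.
Qed.

Lemma loop_end_le_job j k :
  k \in loops (L j) -> S j k + m <= job_completion m L S j.
Proof.
rewrite mem_loops /job_completion /loop_completion => /andP[k_gt0].
rewrite leq_eqVlt => /orP[/eqP-> //|lt_kL].
by have := loop_start_spacing k_gt0 lt_kL (leqnn _); lia.
Qed.

Definition job_in_process (t : nat) (j : 'I_n) : nat :=
  \sum_(k <- loops (L j)) (S j k <= t < S j k + m).

Lemma job_in_process_le t j :
  job_in_process t j <= (t < job_completion m L S j).
Proof.
rewrite /job_in_process sum_nat_of_bool; set p := (p in count p _).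
have [/hasP[k kL Pk]|] := boolP (has p (loops (L j))); last first.
  by rewrite has_count -leqNgt => /leq_trans->.
rewrite /p in Pk; rewrite /p {p}.
have -> : t < job_completion m L S j.
  by apply: leq_trans (loop_end_le_job kL); case/andP: Pk.
rewrite -size_filter; apply: (uniq_leq_size (s2 := [:: k])).
  by rewrite filter_uniq // iota_uniq.
move=> k'; rewrite mem_filter inE => /andP[Pk' k'L].
move: kL k'L; rewrite !mem_loops => kL k'L.
case: (ltngtP k' k) => // lt_k.
  by have := @loop_start_spacing j k' k; lia.
by have := @loop_start_spacing j k k'; lia.
Qed.

(** The loops in process at time t started in distinct slots among
    t - m + 1, ..., t; near time 0 there are only t + 1 such slots. *)
Lemma in_process_le t (B : {set 'I_n}) :
  \sum_(j in B) job_in_process t j <= minn m t.+1.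
Proof.
pose starts := [seq S j k | j <- enum B, k <- loops (L j)].
have -> : \sum_(j in B) job_in_process t j =
          count (fun s => s <= t < s + m) starts.
  by rewrite -sum_nat_of_bool big_allpairs_dep big_enum.
rewrite -size_filter.
have -> : minn m t.+1 = size (iota (t.+1 - m) (minn m t.+1)) by rewrite size_iota.
apply: uniq_leq_size => [|s].
  rewrite filter_uniq // allpairs_uniq_dep ?enum_uniq // => [j _|].
    exact: iota_uniq.
  move=> _ _ /allpairsPdep[j [k [_ kL ->]]] /allpairsPdep[j' [k' [_ k'L ->]]] /=.
  by move=> /(sched.1 _ _ _ _ kL k'L)[-> ->].
by rewrite mem_filter mem_iota => /andP[? _]; lia.
Qed.

(** Integrate over time the inequality
    (loops of B in process at t) + (c - (t + 1)) <= (jobs of A unfinished at t),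
    where A contains the last c jobs of B to complete.  The left side adds up to
    m times the number of loops, plus 0 + ... + (c - 1); the right side to the
    completion times of A. *)
Lemma volume_bound (B : {set 'I_n}) : let c := minn m #|B| in
  exists A : {set 'I_n}, [/\ A \subset B, #|A| = c &
    m * (\sum_(j in B) L j) + \sum_(i < c) i
      <= \sum_(j in A) job_completion m L S j].
Proof.
set C := job_completion m L S; move cardB: #|B| => b c.
have le_cB : c <= #|B| by rewrite cardB geq_minr.
have [A [tau [sAB cardA leA geA]]] := top_subset C le_cB.
exists A; split=> //.
(* A horizon after all completions. *)
pose H := m + \max_j C j.
have leCH j : C j <= H by rewrite /H; have := leq_bigmax (F := C) j; lia.
have C_gem j : m <= C j by rewrite /C /job_completion /loop_completion; lia.
have -> : m * (\sum_(j in B) L j) =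
          \sum_(t < H) \sum_(j in B) job_in_process t j.
  rewrite exchange_big /= big_distrr /=; apply: eq_bigr => j _.
  rewrite exchange_big /= -[L j in LHS](size_iota 1) -sum1_size big_distrr /=.
  apply: eq_big_seq => k kL; rewrite muln1 sum_ord_window //.
  exact: leq_trans (loop_end_le_job kL) (leCH j).
have -> : \sum_(j in A) C j = \sum_(t < H) \sum_(j in A) (t < C j).
  by rewrite exchange_big; apply: eq_bigr => j _; rewrite sum_ord_lt.
rewrite -(@sum_ord_countdown c H); last by rewrite /c /H; lia.
rewrite -big_split /=; apply: leq_sum => t _.
have leN : \sum_(j in B) job_in_process t j <= \sum_(j in B) (t < C j).
  by apply: leq_sum => j _; apply: job_in_process_le.
have leNb : \sum_(j in B) (t < C j) <= b.
  by rewrite -cardB -sum1_card; apply: leq_sum => j _; apply: leq_b1.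
have split_B : \sum_(j in B) (t < C j) =
    \sum_(j in A) (t < C j) + \sum_(j in B :\: A) (t < C j).
  by rewrite (big_setID A) /= (setIidPr sAB).
have le_cm : c <= m by rewrite /c geq_minl.
have := in_process_le t B; move: leN leNb split_B.
move: (\sum_(j in B) job_in_process t j) => P.
move: (\sum_(j in B) (t < C j)) => N le_PN le_Nb eq_N le_Pm.
(* In the first case all of A is unfinished, because of tau or because no job
   completes before time m.  In the second case the countdown is over, and the
   unfinished jobs of B are those of A. *)
have [busy|idle] := boolP ((t < tau) || (t.+1 < c)).
  have -> : \sum_(j in A) (t < C j) = c.
    transitivity #|A| => //; rewrite -sum1_card; apply: eq_bigr => j jA.
    have -> // : t < C j by have := leA j jA; have := C_gem j; lia.
  lia.
have rest0 : \sum_(j in B :\: A) (t < C j) = 0.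
  apply: big1 => j jBA; have := geA j jBA.
  by move=> le_C; rewrite ltnNge (leq_trans le_C) //; lia.
rewrite rest0 addn0 in eq_N.
rewrite -{}eq_N.
lia.
Qed.

Variables (l : nat -> nat) (r : 'I_n -> nat).
Hypotheses (l_mono : {homo l : i j / i <= j}) (lr : forall j, l (r j) = L j).
Hypothesis r_inj : injective r.

(** B need not consist of the first jobs, although it is compared with them: the
    induction removes from B the jobs that complete last in S, and what is left
    is an arbitrary set.  The comparison only uses that the first |B| jobs have
    the fewest loops. *)
Lemma track_completions_le (B : {set 'I_n}) :
  \sum_(i < #|B|) track_start m l (i + m) <=
  \sum_(j in B) job_completion m L S j.
Proof.
move: {2}#|B|.+1 (ltnSn #|B|) => b; elim: b B => // b IH B; rewrite ltnS => le_Bb.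
have [A [sAB cardA le_A]] := volume_bound B.
have cardBA : #|B :\: A| = #|B| - m.
  by have := cardsID A B; rewrite (setIidPr sAB) cardA; lia.
have [/eqP B0|B_gt0] := posnP #|B|.
  by move: B0; rewrite cards_eq0 => /eqP->; rewrite cards0 big_ord0.
rewrite sum_track_end // (big_setID A) /= (setIidPr sAB) leq_add //; last first.
  by rewrite -cardBA IH // cardBA; lia.
apply: leq_trans le_A; rewrite leq_add2r leq_mul2l; apply/orP; right.
apply: leq_trans (sum_first_le_sum_image B r_inj l_mono) _.
by apply: leq_sum => j _; rewrite lr.
Qed.

End LowerBound.

(** * The order of the jobs *)

Section Rank.

Variables (R : realFieldType) (n : nat) (L : 'I_n -> nat) (w : 'I_n -> R).
Hypothesis agree : agreeable L w.

Let prec (j j' : 'I_n) : bool :=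
  [&& L j <= L j', (w j' <= w j)%R & (L j < L j') || (w j' < w j)%R].

Let precP j j' : reflect (agreeable_pair L w j j') (prec j j').
Proof.
apply: (iffP and3P) => [[? ? /orP ?]|[? ? ?]]; first by split.
by split=> //; apply/orP.
Qed.

Let prec_irr j : prec j j = false.
Proof. by rewrite /prec ltnn ltxx !andbF. Qed.

Let prec_trans : transitive prec.
Proof.
move=> j2 j1 j3 /and3P[L12 w12 lt12] /and3P[L23 w23 lt23]; apply/and3P; split.
- exact: leq_trans L12 L23.
- exact: le_trans w23 w12.
- case/orP: lt12 => [lt12|lt12]; first by rewrite (leq_trans lt12 L23).
  by rewrite (le_lt_trans w23 lt12) orbT.
Qed.

(** Agreeable pairs form a strict total order, so that counting predecessors
    numbers the jobs 0, ..., n - 1. *)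
Definition rank (j : 'I_n) : nat := #|[set j' | prec j' j]|.

Lemma rank_lt_n j : rank j < n.
Proof.
rewrite -[leqRHS]card_ord -cardsT; apply/proper_card/properP; split=> //.
by exists j; rewrite ?inE // prec_irr.
Qed.

Lemma agreeable_pair_rank j j' : agreeable_pair L w j j' -> rank j < rank j'.
Proof.
move/precP=> prec_jj'; apply/proper_card/properP; split.
  by apply/subsetP=> i; rewrite !inE => /prec_trans->.
by exists j; rewrite !inE ?prec_irr.
Qed.

Lemma rank_lt_agreeable_pair j j' : rank j < rank j' -> agreeable_pair L w j j'.
Proof.
have [<-|/agree[//|/agreeable_pair_rank]] := eqVneq j j'; first by rewrite ltnn.
lia.
Qed.

Lemma rank_inj : injective rank.
Proof.
move=> j j' eq_r; have [//|/agree] := eqVneq j j'.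
by case=> /agreeable_pair_rank; rewrite eq_r ltnn.
Qed.

Lemma rank_le j j' : rank j <= rank j' -> L j <= L j' /\ (w j' <= w j)%R.
Proof.
rewrite leq_eqVlt => /orP[/eqP/rank_inj->|/rank_lt_agreeable_pair[]] //.
Qed.

Lemma rank_surj i : i < n -> exists j, rank j = i.
Proof.
move=> lt_in; pose f j := Ordinal (rank_lt_n j).
have f_inj : injective f by move=> j j' /(congr1 val)/rank_inj.
by exists (invF f_inj (Ordinal lt_in)); rewrite -[rank _]/(val (f _)) f_invF.
Qed.

(** The number of loops as a function of the rank.  Taking the maximum over all
    ranks up to i, and at least 1, makes it monotone and positive on all of nat,
    also beyond rank n - 1, so that the tracks continue forever. *)
Definition rank_loops (i : nat) : nat := maxn 1 (\max_(j | rank j <= i) L j).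

Lemma rank_loops_gt0 i : 0 < rank_loops i.
Proof. by rewrite leq_max. Qed.

Lemma rank_loops_mono : {homo rank_loops : i i' / i <= i'}.
Proof.
move=> i i' le_ii'; rewrite geq_max leq_maxl /=.
apply/bigmax_leqP => j le_ji; rewrite leq_max; apply/orP; right.
by apply: leq_bigmax_cond; apply: leq_trans le_ii'.
Qed.

Lemma rank_loopsE j : 0 < L j -> rank_loops (rank j) = L j.
Proof.
move=> Lj_gt0; apply/eqP; rewrite eqn_leq geq_max Lj_gt0 /=; apply/andP; split.
  by apply/bigmax_leqP => j' /rank_le[].
by rewrite leq_max leq_bigmax_cond ?orbT.
Qed.

(** Abel summation: as weights decrease along the ranks, the weighted sum over a
    prefix is at least v times the plain sum, for every v below the weights of
    that prefix. *)
Lemma weighted_sum_ge0 (f : 'I_n -> R) :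
  (forall j, 0 <= w j)%R ->
  (forall b : nat, 0 <= \sum_(j | (rank j < b)%N) f j)%R ->
  (0 <= \sum_j w j * f j)%R.
Proof.
move=> w_ge0 f_ge0.
have prefix (b : nat) : b <= n -> forall v : R, (forall j, (rank j < b)%N -> v <= w j)%R ->
    (v * (\sum_(j | (rank j < b)%N) f j) <= \sum_(j | (rank j < b)%N) w j * f j)%R.
  elim: b => [|b IH] lt_bn v le_vw; first by rewrite !big_pred0 ?mulr0.
  have [j0 rj0] := rank_surj lt_bn.
  have split_sum (g : 'I_n -> R) :
      (\sum_(j | (rank j < b.+1)%N) g j = g j0 + \sum_(j | (rank j < b)%N) g j)%R.
    rewrite (bigD1 j0) /= ?rj0 //; congr (_ + _)%R; apply: eq_bigl => j.
    rewrite ltnS leq_eqVlt -rj0 (inj_eq rank_inj).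
    by have [->|] := eqVneq j j0; rewrite ?ltnn ?andbT.
  (* w j0 is the smallest weight of the prefix, so the induction hypothesis
     applies with v := w j0. *)
  apply: le_trans (ler_wpM2r (f_ge0 _) (le_vw j0 _)) _; first by rewrite rj0.
  rewrite !split_sum mulrDr lerD2l IH ?(ltnW lt_bn) // => j lt_jb.
  by have [] := @rank_le j j0 _; rewrite // rj0 ltnW.
have all_lt (g : 'I_n -> R) : (\sum_(j | (rank j < n)%N) g j = \sum_j g j)%R.
  by apply: eq_bigl => j; rewrite rank_lt_n.
by have := prefix n (leqnn n) 0%R (fun j _ => w_ge0 j); rewrite mul0r all_lt.
Qed.

Lemma sum_rank_prefix (g : nat -> nat) b : b <= n ->
  \sum_(j | rank j < b) g (rank j) = \sum_(i < b) g i.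
Proof.
move=> le_bn; pose f j := Ordinal (rank_lt_n j).
have f_inj : injective f by move=> j j' /(congr1 val)/rank_inj.
by rewrite (big_ord_widen _ _ le_bn) [RHS](reindex_inj f_inj).
Qed.

Lemma card_rank_prefix b : b <= n -> #|[set j | rank j < b]| = b.
Proof.
move=> le_bn; rewrite cardsE -sum1_card.
by rewrite (sum_rank_prefix (fun=> 1) le_bn) sum1_card card_ord.
Qed.

End Rank.

(** * LRL schedules are the list schedules on tracks *)

Section LRLSchedules.

Variables (R : realFieldType) (m n : nat) (L : 'I_n -> nat) (w : 'I_n -> R).
Hypotheses (m_gt0 : 0 < m) (L_gt0 : forall j, 0 < L j).
Hypothesis agree : agreeable L w.

Let r : 'I_n -> nat := rank L w.
Let start (i : nat) : nat := track_start m (rank_loops L w) i.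

Let start_lt : {homo start : i i' / i < i'}.
Proof.
exact: (track_start_lt m_gt0 (rank_loops_gt0 L w) (@rank_loops_mono _ _ L w)).
Qed.

Let start_le : {mono start : i i' / i <= i'}.
Proof. exact/leq_mono/start_lt. Qed.

Let start_end j : start (r j + m) = start (r j) + m * L j.
Proof. by rewrite /start track_startD // rank_loopsE. Qed.

Let cover t :
  exists2 i, i = t %[mod m] & start i <= t < start (i + m).
Proof. exact: (track_cover m_gt0 (rank_loops_gt0 L w)). Qed.

Let end_le i i' : i = i' %[mod m] -> i < i' -> start (i + m) <= start i'.
Proof.
exact: (track_end_le m_gt0 (rank_loops_gt0 L w) (@rank_loops_mono _ _ L w)).
Qed.

Lemma slot_in_track t j :
  r j = t %[mod m] -> start (r j) <= t -> t < start (r j + m) ->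
  exists2 k, k \in loops (L j) & t = start (r j) + k.-1 * m.
Proof.
move=> Et le_t; rewrite start_end => lt_t.
have : start (r j) = t %[mod m] by rewrite track_start_mod.
move/eqP; rewrite eq_sym eqn_mod_dvd // => /dvdnP[q Eq].
exists q.+1; last by rewrite -Eq subnKC.
rewrite mem_loops /= -(ltn_pmul2r m_gt0) -Eq; lia.
Qed.

Lemma remaining_unstarted (S : 'I_n -> nat -> nat) t j :
  (forall k, k \in loops (L j) -> t <= S j k) -> remaining_loops L S t j = L j.
Proof.
move=> le_t; rewrite /remaining_loops (eq_in_count (a2 := predT)).
  by rewrite count_predT size_iota.
by move=> k /le_t.
Qed.

Lemma remaining_le (S : 'I_n -> nat -> nat) t j :
  remaining_loops L S t j <= L j.
Proof. by apply: leq_trans (count_size _ _) _; rewrite size_iota. Qed.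

Lemma remaining_lt (S : 'I_n -> nat -> nat) t j k :
  k \in loops (L j) -> S j k < t -> remaining_loops L S t j < L j.
Proof.
move=> kL lt_kt; rewrite ltn_neqAle remaining_le andbT /remaining_loops.
rewrite -[X in _ != X](size_iota 1) -all_count; apply/allPn; exists k => //.
by rewrite -ltnNge.
Qed.

Lemma available_unstarted (S : 'I_n -> nat -> nat) t j :
  (forall k, k \in loops (L j) -> t <= S j k) -> available m L S t j.
Proof.
move=> le_t; apply/andP; split; last first.
  by apply/allP=> k /le_t; rewrite leqNgt => /negPf->.
have oneL : 1 \in loops (L j) by rewrite mem_loops L_gt0.
by apply/hasP; exists 1; last exact: le_t.
Qed.

Section Characterization.

Variable S : 'I_n -> nat -> nat.
Hypothesis lrl : is_LRL_schedule m L w S.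

Let sched : is_schedule m L S := lrl.1.

Lemma first_start_le j k : k \in loops (L j) -> S j 1 <= S j k.
Proof.
rewrite mem_loops => kL; have [->//|k1] := eqVneq k 1.
by have := @loop_start_spacing m n L S m_gt0 sched j 1 k; lia.
Qed.

(** When j starts, j' is still untouched and hence available with all its loops,
    so the rule preferred j to it. *)
Lemma first_start_rank j j' : S j 1 < S j' 1 -> r j < r j'.
Proof.
move=> lt_S; have jL : 1 \in loops (L j) by rewrite mem_loops L_gt0.
have jT k : k \in loops (L j) -> S j 1 <= S j k := @first_start_le j k.
have j'T k : k \in loops (L j') -> S j 1 <= S j' k.
  by move/first_start_le; apply: leq_trans; apply: ltnW.
have [|j0 [k0 [choice next eq_t]]] := lrl.2 (S j 1).
  by exists j; apply: available_unstarted.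
have [k0L _ _] := next.
have [Ej _] := sched.1 _ _ _ _ k0L jL eq_t; subst j0.
have := choice.2 j' (available_unstarted j'T).
rewrite !remaining_unstarted // => le_jj'.
rewrite ltnNge; apply/negP; rewrite leq_eqVlt => /orP[/eqP/(rank_inj agree) Ej|].
  by move: lt_S; rewrite Ej ltnn.
move/(rank_lt_agreeable_pair agree) => [Ljj' wjj' strict].
case: le_jj' => [|[eqL le_w]]; first by rewrite ltnNge Ljj'.
by case: strict; rewrite ?eqL ?ltnn // ltNge le_w.
Qed.

(** At time t = S j k + m job j is available.  The job chosen at t is not a new
    one, which would have more remaining loops than j.  It is then a started job
    whose previous loop ended at t, since by induction on t it did not wait
    either; this previous loop started at S j k, hence is loop k of j. *)
Lemma no_wait j k : 0 < k < L j -> S j k.+1 = S j k + m.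
Proof.
move Et : (S j k + m) => t; elim/ltn_ind: t j k Et => t IH j k Et /andP[k_gt0 lt_kL].
have kL : k \in loops (L j) by rewrite mem_loops; lia.
have spacing := @loop_start_spacing m n L S m_gt0 sched j.
have av_j : available m L S t j.
  apply/andP; split.
    apply/hasP; exists k.+1; first by rewrite mem_loops; lia.
    by rewrite -Et spacing.
  apply/allP=> k'; rewrite mem_loops /loop_completion => k'L; apply/implyP => lt_t.
  case: (ltngtP k' k) => [lt_k'|lt_k'|->]; last by rewrite Et.
    by have := spacing k' k; lia.
  by have := spacing k k'; lia.
have [|j0 [k0 [[av0 choice] [k0L _ _] eq_t]]] := lrl.2 t; first by exists j.
have [k0_1|k0_gt1] := leqP k0 1.
  (* A job that has not started yet has more loops left than j, because j was
     preferred to it when j started. *)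
  have Ek0 : k0 = 1 by move: k0L; rewrite mem_loops; lia.
  have lt_kt : S j k < t by lia.
  have lt_jj0 : S j 1 < S j0 1.
    by rewrite -{2}Ek0 eq_t (leq_ltn_trans (first_start_le kL)).
  have [le_L _] := rank_le agree (ltnW (first_start_rank lt_jj0)).
  have rem_j0 : remaining_loops L S t j0 = L j0.
    by apply: remaining_unstarted => k' /first_start_le; rewrite -{1}Ek0 eq_t.
  by have := remaining_lt kL lt_kt; have := choice j av_j; rewrite rem_j0; lia.
have : S j0 k0.-1 + m <= t.
  by rewrite -eq_t; apply: sched.2.
rewrite leq_eqVlt => /orP[/eqP eq_prev|lt_prev].
  have k0'L : k0.-1 \in loops (L j0) by move: k0L; rewrite !mem_loops; lia.
  have eqS : S j0 k0.-1 = S j k by lia.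
  have [Ej Ek] := sched.1 _ _ _ _ k0'L kL eqS.
  by rewrite -Ej -eq_t; congr (S j0 _); lia.
have := IH _ lt_prev j0 k0.-1 erefl; rewrite prednK; last by lia.
by move: k0L; rewrite mem_loops => k0L /(_ ltac:(lia)); lia.
Qed.

Lemma LRL_start_from_first j k : k \in loops (L j) -> S j k = S j 1 + k.-1 * m.
Proof.
rewrite mem_loops; elim: k => // -[|k] IH kL; first by rewrite addn0.
by rewrite no_wait ?IH //=; lia.
Qed.

(** By induction on the rank.  Before start b, every slot belongs to a track held
    by a job of smaller rank.  At start b no started job claims the slot, so an
    unstarted job must start, and jobs start in the order of their ranks. *)
Lemma LRL_first_start j : S j 1 = start (r j).
Proof.
move Eb : (r j) => b; elim/ltn_ind: b j Eb => b IH j Eb.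
have jL : 1 \in loops (L j) by rewrite mem_loops L_gt0.
case: (ltngtP (S j 1) (start b)) => // [lt_S|gt_S].
  (* The track holding slot S j 1 belongs to a job of smaller rank, which uses
     this slot itself. *)
  have [i Ei /andP[le_i lt_i]] := cover (S j 1).
  have lt_ib : i < b by rewrite ltnNge -start_le -ltnNge; lia.
  have [|j1 Ej1] := rank_surj agree (i := i).
    by rewrite (ltn_trans lt_ib) // -Eb rank_lt_n.
  rewrite -[i]Ej1 in Ei le_i lt_i.
  have [k kL Ek] := slot_in_track Ei le_i lt_i.
  have [] := sched.1 j1 j k 1 kL jL; last by move=> Ej; move: lt_ib; rewrite -Ej1 Ej -Eb ltnn.
  by rewrite (LRL_start_from_first kL) (IH i) // -Ej1 -Ek.
have [|j0 [k0 [_ [k0L _ _] eq_t]]] := lrl.2 (start b).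
  exists j; apply: available_unstarted => k /first_start_le; apply: leq_trans.
  exact: ltnW.
have lt_j0b : r j0 < b.
  rewrite -Eb; apply: first_start_rank.
  by apply: leq_ltn_trans (first_start_le k0L) _; rewrite eq_t.
move: eq_t; rewrite (LRL_start_from_first k0L) (IH _ lt_j0b j0 erefl) => eq_t.
(* So slot start b lies on the track of j0, which is busy only until the next
   job of this track starts, at start b or earlier. *)
have same_track : r j0 = b %[mod m].
  rewrite -(track_start_mod m (rank_loops L w) (r j0)).
  by rewrite -(track_start_mod m (rank_loops L w) b) -/(start b) -eq_t addnC modnMDl.
have := end_le same_track lt_j0b; rewrite start_end -eq_t leq_add2l mulnC leq_mul2r.
by move: k0L; rewrite mem_loops; lia.
Qed.

Lemma LRL_completion j :
  job_completion m L S j = track_start m (rank_loops L w) (r j + m).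
Proof.
rewrite -/(start _) start_end -LRL_first_start.
rewrite /job_completion /loop_completion LRL_start_from_first; last first.
  by rewrite mem_loops L_gt0 leqnn.
by have := L_gt0 j; case: (L j) => // k _; rewrite /= -addnA -mulSnr mulnC.
Qed.

End Characterization.

(** * Existence of an LRL schedule *)

Definition track_schedule (j : 'I_n) (k : nat) : nat :=
  start (r j) + k.-1 * m.

Lemma track_schedule_mod j k : track_schedule j k = r j %[mod m].
Proof. by rewrite /track_schedule addnC modnMDl track_start_mod. Qed.

Lemma track_schedule_ge j k : start (r j) <= track_schedule j k.
Proof. exact: leq_addr. Qed.

Lemma track_schedule_lt_end j k :
  k \in loops (L j) -> track_schedule j k < start (r j + m).
Proof.
rewrite mem_loops /track_schedule start_end ltn_add2l mulnC ltn_pmul2l //.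
by lia.
Qed.

Lemma track_schedule_is_schedule : is_schedule m L track_schedule.
Proof.
split=> [j j' k k' kL k'L eq_S|j k kL k_ge2]; last first.
  rewrite /loop_completion /track_schedule -addnA leq_add2l -mulSnr.
  by rewrite leq_mul2r; lia.
have Er : r j = r j' %[mod m].
  by rewrite -(track_schedule_mod j k) eq_S track_schedule_mod.
have lt_end := track_schedule_lt_end kL.
have lt_end' := track_schedule_lt_end k'L.
have Ej : j = j'.
  apply: (rank_inj agree); rewrite -/(r j) -/(r j').
  case: (ltngtP (r j) (r j')) => // lt_r.
    by have := end_le Er lt_r; have := track_schedule_ge j' k'; lia.
  by have := end_le (esym Er) lt_r; have := track_schedule_ge j k; lia.
subst j'; split=> //; move/eqP: eq_S; rewrite eqn_add2l eqn_pmul2r //.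
by move: kL k'L; rewrite !mem_loops; lia.
Qed.

Lemma track_schedule_lt j k k' : 0 < k ->
  (track_schedule j k < track_schedule j k') = (k < k').
Proof. by move=> k_gt0; rewrite ltn_add2l ltn_pmul2r //; lia. Qed.

(** A started job of this schedule is available only at the very moment when its
    next loop starts, since it never waits. *)
Lemma track_schedule_available t j : available m L track_schedule t j ->
  t <= start (r j) \/
  exists2 k, k \in loops (L j) & track_schedule j k = t.
Proof.
move=> /andP[/hasP[k0 k0L le_t] /allP done_t].
have [le_t0|lt_start] := leqP t (start (r j)); [by left | right].
have ex_k : exists k, (k \in loops (L j)) && (t <= track_schedule j k).
  by exists k0; rewrite k0L.
have [k /andP[kL le_tk] min_k] := ex_minnP ex_k.
exists k => //; apply/eqP; rewrite eqn_leq le_tk andbT.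
move: (kL); rewrite mem_loops => /andP[k_gt0 le_kL].
have k_gt1 : 1 < k.
  rewrite ltn_neqAle k_gt0 andbT; apply/eqP => k1.
  by move: le_tk; rewrite -k1 /track_schedule; lia.
have pkL : k.-1 \in loops (L j) by rewrite mem_loops; lia.
have lt_pk : track_schedule j k.-1 < t.
  by rewrite ltnNge; apply/negP => le_tpk; have := min_k k.-1; rewrite pkL le_tpk; lia.
have := implyP (done_t _ pkL) lt_pk; apply: leq_trans.
rewrite /loop_completion /track_schedule -addnA leq_add2l -mulSnr leq_mul2r; lia.
Qed.

(** The choice at t is the job holding the track of t.  Such a job exists among
    the n actual jobs as soon as some job is available, because its rank is at
    most the rank of the available one. *)
Lemma track_schedule_is_LRL : is_LRL_schedule m L w track_schedule.
Proof.
split=> [|t [j' av_j']]; first exact: track_schedule_is_schedule.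
have [i Ei /andP[le_i lt_i]] := cover t.
have le_ij' : i <= r j'.
  have [le_t|[k kL Et]] := track_schedule_available av_j'.
    by rewrite -start_le (leq_trans le_i).
  have Er : r j' = i %[mod m] by rewrite Ei -Et track_schedule_mod.
  rewrite leqNgt; apply/negP => lt_r; have := end_le Er lt_r.
  by have := track_schedule_lt_end kL; rewrite Et; lia.
have [|j Ej] := rank_surj agree (i := i).
  exact: leq_ltn_trans le_ij' (rank_lt_n _ _ _).
rewrite -/(r j) in Ej; subst i.
have [k kL Et] := slot_in_track Ei le_i lt_i.
rewrite -/(track_schedule j k) in Et; subst t.
have k_gt0 : 0 < k by move: kL; rewrite mem_loops => /andP[].
exists j, k; split=> //; last first.
  split=> // k'; rewrite mem_loops => /andP[k'_gt0 _].
  by rewrite track_schedule_lt.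
split=> [|j1 av_j1].
  apply/andP; split; first by apply/hasP; exists k.
  apply/allP=> k'; rewrite mem_loops => /andP[k'_gt0 _].
  apply/implyP; rewrite track_schedule_lt // => lt_k'k.
  by rewrite /loop_completion /track_schedule -addnA leq_add2l -mulSnr leq_mul2r; lia.
have [le_t|[k1 k1L Et]] := track_schedule_available av_j1; last first.
  have [-> _] := track_schedule_is_schedule.1 _ _ _ _ k1L kL Et.
  by right; rewrite lexx.
have rem_j1 : remaining_loops L track_schedule (track_schedule j k) j1 = L j1.
  by apply: remaining_unstarted => k1 _; apply: leq_trans le_t (leq_addr _ _).
have le_r : r j <= r j1 by rewrite -start_le (leq_trans le_i).
have [le_L le_w] := rank_le agree le_r.
have := leq_trans (remaining_le track_schedule (track_schedule j k) j) le_L.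
by rewrite -rem_j1 leq_eqVlt => /orP[/eqP|]; [right | left].
Qed.

End LRLSchedules.

Theorem lemma4p9 (R : realFieldType) (m n : nat)
    (L : 'I_n -> nat) (w : 'I_n -> R) :
  1 <= m ->
  (forall j, 1 <= L j) ->
  (forall j, (0 < w j)%R) ->
  agreeable L w ->
  (exists S, is_LRL_schedule m L w S) /\
  (forall S, is_LRL_schedule m L w S ->
   forall S', is_schedule m L S' ->
     (total_weighted_completion m L w S <=
      total_weighted_completion m L w S')%R).
Proof.
move=> m_gt0 L_gt0 w_gt0 agree; split=> [|S lrl S' sched'].
  by exists (track_schedule m L w); apply: track_schedule_is_LRL.
rewrite -subr_ge0 /total_weighted_completion -sumrB.
under eq_bigr do rewrite -mulrBr.
apply: (weighted_sum_ge0 agree) => [j|b]; first exact: ltW.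
wlog le_bn : b / b <= n => [prefix_ge0|].
  have [/prefix_ge0//|lt_nb] := leqP b n.
  rewrite (eq_bigl (fun j => rank L w j < n)%N); first exact: prefix_ge0.
  by move=> j; rewrite rank_lt_n (ltn_trans (rank_lt_n L w j)).
rewrite sumrB subr_ge0 -!natr_sum ler_nat.
rewrite (eq_bigr (fun j => track_start m (rank_loops L w) (rank L w j + m))).
  rewrite (sum_rank_prefix agree (fun i => track_start m (rank_loops L w) (i + m))) //.
  have := track_completions_le m_gt0 sched'.
  move=> /(_ _ _ (@rank_loops_mono _ _ L w) (fun j => rank_loopsE agree (L_gt0 j))).
  move=> /(_ (rank_inj agree) [set j | rank L w j < b]).
  rewrite card_rank_prefix // => /leq_trans-> //.
  by rewrite (eq_bigl (fun j => rank L w j < b)) // => j; rewrite inE.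
by move=> j _; apply: LRL_completion.
Qed.
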